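(* Let $N\ge3$. The automorphisms $T_i$ ($i\in\mathbb{Z}/N\mathbb{Z}$) of the affine Yangian $Y(\hat{\mathfrak{sl}}_N)$ satisfy the braid relations, that is, for $i,j\in\mathbb{Z}/N\mathbb{Z}$, $$T_iT_j=T_jT_i\ \text{ if } a_{ij}=0,\qquad T_iT_jT_i=T_jT_iT_j\ \text{ if } a_{ij}=-1.$$
   Context: Affine Yangian. $Y(\hat{\mathfrak{sl}}_N)$ is the $\mathbb{C}$-algebra generated by $x_{i,r}^{+},x_{i,r}^-,h_{i,r}$ ($i\in\mathbb{Z}/N\mathbb{Z}$, $r\in\mathbb{Z}_{\ge0}$) with parameters $\varepsilon_1,\varepsilon_2\in\mathbb{C}$ and relations $[h_{i,r},h_{j,s}]=0$, $[x_{i,r}^+,x_{j,s}^-]=\delta_{ij}h_{i,r+s}$, $[h_{i,0},x_{j,r}^\pm]=\pm a_{ij}x_{j,r}^\pm$, $[h_{i,r+1},x_{j,s}^\pm]-[h_{i,r},x_{j,s+1}^\pm]=\pm a_{ij}\frac{\varepsilon_1+\varepsilon_2}{2}\{h_{i,r},x_{j,s}^\pm\}-m_{ij}\frac{\varepsilon_1-\varepsilon_2}{2}[h_{i,r},x_{j,s}^\pm]$, $[x_{i,r+1}^\pm,x_{j,s}^\pm]-[x_{i,r}^\pm,x_{j,s+1}^\pm]=\pm a_{ij}\frac{\varepsilon_1+\varepsilon_2}{2}\{x_{i,r}^\pm,x_{j,s}^\pm\}-m_{ij}\frac{\varepsilon_1-\varepsilon_2}{2}[x_{i,r}^\pm,x_{j,s}^\pm]$,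 $\sum_{w\in\mathfrak{S}_{1-a_{ij}}}[x_{i,r_{w(1)}}^\pm,[x_{i,r_{w(2)}}^\pm,\dots,[x_{i,r_{w(1-a_{ij})}}^\pm,x_{j,s}^\pm]\dots]]=0$ for $i\ne j$. Here $\{x,y\}=xy+yx$; $a_{ij}=2$ if $i=j$, $-1$ if $i=j\pm1$, $0$ otherwise; $m_{ij}=1$ if $j=i-1$, $-1$ if $j=i+1$, $0$ otherwise. Put $x_i^\pm=x_{i,0}^\pm$, $h_i=h_{i,0}$. Braid operators: $T_i=\exp\mathrm{ad}\,x_i^+\,\exp\mathrm{ad}(-x_i^-)\,\exp\mathrm{ad}\,x_i^+$, an algebra automorphism of $Y(\hat{\mathfrak{sl}}_N)$ (the $\mathrm{ad}\,x_i^\pm$ are locally nilpotent derivations, $\exp\mathrm{ad}\,x=\sum_{n\ge0}\frac1{n!}(\mathrm{ad}\,x)^n$). *)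

(* Defs.v *)
From HB Require Import structures.
From mathcomp Require Import all_boot all_order all_algebra perm generic_quotient.
From mathcomp Require Import boolp reals complex monalg zify.

Set Implicit Arguments.
Unset Strict Implicit.
Unset Printing Implicit Defensive.

Import GRing.Theory Num.Theory.
Local Open Scope ring_scope.
Local Open Scope quotient_scope.

Section Bracket.
Variable A : pzRingType.

Definition bracket (x y : A) : A := x * y - y * x.
Definition anticomm (x y : A) : A := x * y + y * x.

End Bracket.

Section LieLemmas.
Variables (K : comNzRingType) (A : algType K).
Implicit Types x y z : A.

Fact bracket_is_linear x : linear (bracket x).
Proof.
move=> c y z; rewrite /bracket mulrDr mulrDl -scalerAr -scalerAl opprD addrACA.
by rewrite scalerBr.
Qed.
HB.instance Definition _ x :=
  GRing.isLinear.Build K A A *:%R (bracket x) (bracket_is_linear x).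

Lemma bracketM x y z : bracket x (y * z) = bracket x y * z + y * bracket x z.
Proof. by rewrite /bracket mulrBl mulrBr !mulrA addrA subrK. Qed.

Lemma bracketC x y : bracket x y = - bracket y x.
Proof. by rewrite /bracket opprB. Qed.

Lemma bracketNl x y : bracket (- x) y = - bracket x y.
Proof. by rewrite /bracket mulNr mulrN -opprD. Qed.

End LieLemmas.

Definition locally_nilpotent (V : nmodType) (f : V -> V) : Prop :=
  forall v, exists n, iter n f v == 0.

Section Exp.
Variables (K : numFieldType) (V : lmodType K).

(* The sum stops at the first vanishing iterate; exp_lnE shows that the       *)
(* cut-off is irrelevant once an iterate vanishes.                            *)
Definition exp_ln (f : V -> V) (fN : locally_nilpotent f) (v : V) : V :=
  \sum_(k < ex_minn (fN v)) (k`!%:R^-1 : K) *: iter k f v.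

End Exp.

Section ExpLinear.
Variables (K : numFieldType) (V : lmodType K) (f : {linear V -> V}).

Lemma iter_eq0 m n v : (m <= n)%N -> iter m f v = 0 -> iter n f v = 0.
Proof.
move=> /subnK <-; rewrite iterD => ->; elim: (n - m)%N => //= k ->.
exact: linear0.
Qed.

Lemma iter_linear n : linear (iter n f).
Proof. by elim: n => // n IH c u v; rewrite !iterS IH linearP. Qed.

Hypothesis fN : locally_nilpotent f.

Lemma exp_lnE n v : iter n f v = 0 ->
  exp_ln fN v = \sum_(k < n) (k`!%:R^-1 : K) *: iter k f v.
Proof.
rewrite /exp_ln; case: ex_minnP => m /eqP m0 mmin n0.
have lmn : (m <= n)%N by apply: mmin; apply/eqP.
rewrite (big_ord_widen _ (fun k => (k`!%:R^-1 : K) *: iter k f v) lmn).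
rewrite [RHS](bigID (fun k : 'I_n => (k < m)%N)) /=.
rewrite [X in _ = _ + X]big1 ?addr0 // => k; rewrite -leqNgt => lmk.
by rewrite (iter_eq0 lmk m0) scaler0.
Qed.

Lemma exp_ln_linear : linear (exp_ln fN).
Proof.
move=> c u v; have [p /eqP p0] := fN u; have [q /eqP q0] := fN v.
have p1 := iter_eq0 (leq_addr q p) p0; have q1 := iter_eq0 (leq_addl p q) q0.
have s1 : iter (p + q) f (c *: u + v) = 0.
  by rewrite iter_linear p1 q1 scaler0 addr0.
rewrite (exp_lnE p1) (exp_lnE q1) (exp_lnE s1) scaler_sumr -big_split /=.
by apply: eq_bigr => k _; rewrite iter_linear scalerDr !scalerA mulrC.
Qed.
HB.instance Definition _ :=
  GRing.isLinear.Build K V V *:%R (exp_ln fN) exp_ln_linear.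

End ExpLinear.

Lemma big_triangle (V : nmodType) (F : nat -> nat -> V) M :
  \sum_(n < M) \sum_(k < n.+1) F k (n - k)%N =
  \sum_(k < M) \sum_(l < M - k) F k l.
Proof.
elim: M => [|M IH]; first by rewrite !big_ord0.
rewrite big_ord_recr IH /= [in LHS]big_ord_recr [RHS]big_ord_recr /=.
rewrite subnn subSnn big_ord1 addrA; congr (_ + _).
rewrite -big_split; apply: eq_bigr => k _ /=.
by rewrite subSn ?(ltnW (ltn_ord k)) // big_ord_recr.
Qed.

Lemma fact_binV (K : numFieldType) n k : (k <= n)%N ->
  n`!%:R^-1 * 'C(n, k)%:R = k`!%:R^-1 * (n - k)`!%:R^-1 :> K.
Proof.
move=> lkn; rewrite -(bin_fact lkn) !natrM.
have b0 : 'C(n, k)%:R != 0 :> K by rewrite pnatr_eq0 -lt0n bin_gt0.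
have f0 m : m`!%:R != 0 :> K by rewrite pnatr_eq0 -lt0n fact_gt0.
by rewrite invfM mulrAC mulVf // mul1r invfM.
Qed.

Lemma sum_square_triangle (V : zmodType) (F : nat -> nat -> V) p q M :
  (p + q <= M)%N ->
  (forall k l, ((p <= k) || (q <= l))%N -> F k l = 0) ->
  \sum_(k < M) \sum_(l < M - k) F k l = \sum_(k < M) \sum_(l < M) F k l.
Proof.
move=> lM F0; apply: eq_bigr => k _.
rewrite (big_ord_widen _ (F k) (leq_subr k M)).
rewrite [RHS](bigID (fun l : 'I_M => (l < M - k)%N)) /=.
rewrite [X in _ = _ + X]big1 ?addr0 // => l; rewrite -leqNgt => hl.
apply: F0; case: (leqP p k) => //= hk.
by have := ltn_ord k; lia.
Qed.

Section ExpInv.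
Variables (K : numFieldType) (V : lmodType K) (f g : {linear V -> V}).
Hypotheses (gE : forall v, g v = - f v).
Hypotheses (fN : locally_nilpotent f) (gN : locally_nilpotent g).

Lemma iter_opp n v : iter n g v = (-1) ^+ n *: iter n f v.
Proof.
elim: n => [|n IH] /=; first by rewrite scale1r.
by rewrite IH gE linearZ /= exprS mulN1r scaleNr.
Qed.

Lemma exp_lnK : cancel (exp_ln fN) (exp_ln gN).
Proof.
move=> v; have [p /eqP p0] := fN v; set M := (p + p)%N.
have lpM : (p <= M)%N by rewrite leq_addr.
have gz k : iter M g (iter k f v) = 0.
  by rewrite iter_opp -iterD (iter_eq0 _ p0) ?scaler0 // /M -addnA leq_addr.
rewrite (exp_lnE fN (iter_eq0 lpM p0)) linear_sum /=.
under eq_bigr => k _ do rewrite linearZ /= (exp_lnE gN (gz k)) scaler_sumr.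
pose F k l := (k`!%:R^-1 : K) *: ((l`!%:R^-1 : K) *: iter l g (iter k f v)).
rewrite -[LHS](@sum_square_triangle _ F p p M) //; last first.
  move=> k l /orP[lk|lk]; rewrite /F iter_opp -iterD (iter_eq0 _ p0) ?scaler0 //.
    by rewrite (leq_trans lk) ?leq_addl.
  by rewrite (leq_trans lk) ?leq_addr.
rewrite -big_triangle.
have FE n : \sum_(k < n.+1) F k (n - k)%N = (n == 0)%:R *: v.
  transitivity (((n`!%:R)^-1 * (-1 + 1) ^+ n : K) *: iter n f v); last first.
    by rewrite addrC subrr expr0n; case: n => [|n] /=;
      rewrite ?invr1 ?mulr1 ?mulr0 ?scale0r.
  rewrite exprDn mulr_sumr scaler_suml; apply: eq_bigr => k _.
  have lkn : (k <= n)%N by rewrite -ltnS.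
  rewrite /F iter_opp -iterD subnK // !scalerA expr1n mulr1; congr (_ *: _).
  by rewrite -fact_binV // -mulrA mulr_natl.
under eq_bigr => n _ do rewrite FE.
case: M lpM {gz} => [|M' _]; last first.
  by rewrite big_ord_recl scale1r big1 ?addr0 // => n _; rewrite scale0r.
by rewrite leqn0 big_ord0 => /eqP pz; rewrite pz /= in p0.
Qed.

End ExpInv.

Section ExpDerivation.
Variables (K : numFieldType) (A : algType K) (D : {linear A -> A}).
Hypothesis DM : forall a b, D (a * b) = D a * b + a * D b.

Lemma iter_leibniz n a b :
  iter n D (a * b) = \sum_(k < n.+1) (iter k D a * iter (n - k) D b) *+ 'C(n, k).
Proof.
elim: n => [|n IH]; first by rewrite big_ord1 bin0 mulr1n.
rewrite iterS IH linear_sum.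
under eq_bigr => k _ do rewrite linearMn /= DM mulrnDl -iterS.
rewrite big_split /= [RHS]big_ord_recl [RHS]addrC /=.
under [X in _ = X + _]eq_bigr => k _ do
  rewrite /bump /= add1n binS mulrnDr subSS addrC.
rewrite big_split /= -addrA; congr (_ + _).
rewrite big_ord_recl [X in _ = X + _]big_ord_recr /= (bin_small (ltnSn n)) mulr0n addr0.
rewrite !bin0 !subn0 addrC; congr (_ + _); apply: eq_bigr => k _.
by rewrite /bump /= add1n -[in RHS](subnSK (ltn_ord k)).
Qed.

Lemma iter_mul_eq0 p q a b :
  iter p D a = 0 -> iter q D b = 0 -> iter (p + q) D (a * b) = 0.
Proof.
move=> pa qb; rewrite iter_leibniz big1 // => k _.
case: (leqP p k) => [lpk|lkp]; first by rewrite (iter_eq0 lpk pa) mul0r mul0rn.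
by rewrite (iter_eq0 _ qb) ?mulr0 ?mul0rn //; lia.
Qed.

Hypothesis DN : locally_nilpotent D.

Lemma exp_ln_monoid_morphism : monoid_morphism (exp_ln DN).
Proof.
have D1 : D 1 = 0.
  by have /eqP := DM 1 1; rewrite !mulr1 mul1r -subr_eq subrr eq_sym => /eqP.
split; first by rewrite (@exp_lnE _ _ _ _ 1%N) // big_ord1 /= invr1 scale1r.
move=> a b; have [p /eqP p0] := DN a; have [q /eqP q0] := DN b.
have pq0 := iter_mul_eq0 p0 q0; set M := (p + q)%N in pq0.
rewrite (exp_lnE DN pq0) (exp_lnE DN (iter_eq0 (leq_addr q p) p0)).
rewrite (exp_lnE DN (iter_eq0 (leq_addl p q) q0)) mulr_suml.
under [RHS]eq_bigr => k _ do rewrite mulr_sumr.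
pose F k l := (k`!%:R^-1 *: iter k D a) * (l`!%:R^-1 *: iter l D b) : A.
rewrite -[RHS](@sum_square_triangle _ F p q M) //; last first.
  move=> k l /orP[lk|lk]; first by rewrite /F (iter_eq0 lk p0) scaler0 mul0r.
  by rewrite /F (iter_eq0 lk q0) scaler0 mulr0.
rewrite -big_triangle; apply: eq_bigr => n _.
rewrite iter_leibniz scaler_sumr; apply: eq_bigr => k _; rewrite /F.
rewrite -scaler_nat scalerA fact_binV; last by rewrite -ltnS.
by rewrite -scalerAl -scalerAr scalerA.
Qed.

End ExpDerivation.

Section ExpAd.
Variables (K : numFieldType) (A : algType K) (x : A).

Definition exp_ad (xN : locally_nilpotent (bracket x)) : A -> A := exp_ln xN.

Variable xN : locally_nilpotent (bracket x).

HB.instance Definition _ := GRing.Linear.copy (exp_ad xN) (exp_ln xN).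
HB.instance Definition _ := GRing.isMonoidMorphism.Build A A (exp_ad xN)
  (exp_ln_monoid_morphism (bracketM x) xN).

Lemma locally_nilpotentN : locally_nilpotent (bracket (- x)).
Proof.
move=> v; have [n /eqP n0] := xN v; exists n; apply/eqP.
by rewrite (iter_opp (f := bracket x)) ?n0 ?scaler0 // => w; exact: bracketNl.
Qed.

Lemma exp_ad_bij : bijective (exp_ad xN).
Proof.
exists (exp_ln locally_nilpotentN); apply: exp_lnK => v /=.
  exact: bracketNl.
by have := bracketNl (- x) v; rewrite opprK.
Qed.

End ExpAd.

Section MalgLemmas.
Variables (K : comNzRingType) (M : monomType).
Implicit Types (u v : {malg K[M]}).

Lemma malg_scalerAr (c : K) u v : c *: (u * v) = u * (c *: v).
Proof.
apply/malgP=> m; rewrite mcoeffZ mcoeffMl.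
rewrite (mcoeffMlw _ (finmap.fsubset_refl _) (msuppZ_le c v)) mulr_sumr.
apply: eq_bigr => k1 _; rewrite mulr_sumr; apply: eq_bigr => k2 _.
by rewrite mcoeffZ mulrCA mulrnAr.
Qed.

Lemma malgUZ (c : K) m : << c *g m >> = c *: << m >> :> {malg K[M]}.
Proof. by apply/malgP=> k; rewrite mcoeffZ !mcoeffU mulr_natr. Qed.

Lemma malgUM (m n : M) : << mmul m n >> = << m >> * << n >> :> {malg K[M]}.
Proof. by rewrite malgM_def fgmulUU mulr1. Qed.

End MalgLemmas.

Definition free_alg (K : comNzRingType) (I : choiceType) : Type :=
  {malg K[{fmonom I}]}.

Section FreeAlg.
Variables (K : comNzRingType) (I : choiceType).

HB.instance Definition _ :=
  GRing.Lalgebra.copy (free_alg K I) {malg K[{fmonom I}]}.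
HB.instance Definition _ :=
  GRing.Lalgebra_isAlgebra.Build K (free_alg K I)
    (@malg_scalerAr K {fmonom I}).

Definition free_gen (i : I) : free_alg K I := << fmu i >>%R.

Lemma free_alg_ind (P : free_alg K I -> Prop) :
  P 0 -> P 1 -> (forall i, P (free_gen i)) ->
  (forall u v, P u -> P v -> P (u + v)) ->
  (forall u v, P u -> P v -> P (u * v)) ->
  (forall c u, P u -> P (c *: u)) ->
  forall u, P u.
Proof.
move=> P0 P1 Pg PD PM PZ u; rewrite (monalgE (u : {malg K[{fmonom I}]})).
apply: (big_ind P) => // m _.
rewrite malgUZ; apply: PZ.
case: m => s; elim: s => [|i s IH]; first by rewrite -fmoneE; exact: P1.
have -> : FMonom (i :: s) = mmul (fmu i) (FMonom s).
  by rewrite /mmul /= fmmulE fmuE.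
by rewrite malgUM; exact: (PM _ _ (Pg i) IH).
Qed.

(* The augmentation, sending every generator to 0.                            *)
Definition free_aug (u : free_alg K I) : K :=
  mcoeff mone (u : {malg K[{fmonom I}]}).
Lemma free_aug_gen i : free_aug (free_gen i) = 0.
Proof. by rewrite /free_aug mcoeffU -val_eqE /= fmU fm1. Qed.

End FreeAlg.

Section TwoSidedIdeal.
Variables (A : pzRingType) (S : A -> A -> Prop).

(* The two-sided ideal generated by the differences u - v with S u v.         *)
Inductive rel_ideal : A -> Prop :=
| rel_ideal_rel u v of S u v : rel_ideal (u - v)
| rel_ideal0 : rel_ideal 0
| rel_idealD u v of rel_ideal u & rel_ideal v : rel_ideal (u + v)
| rel_idealMl w u of rel_ideal u : rel_ideal (w * u)
| rel_idealMr u w of rel_ideal u : rel_ideal (u * w).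

Lemma rel_idealN u : rel_ideal u -> rel_ideal (- u).
Proof. by move=> Su; rewrite -mulN1r; apply: rel_idealMl. Qed.

Lemma rel_ideal_equiv : equiv_class_of (fun u v : A => `[< rel_ideal (u - v) >]).
Proof.
split=> [u | u v | v u w].
- by apply/asboolP; rewrite subrr; apply: rel_ideal0.
- by apply/asboolP/asboolP => /rel_idealN; rewrite opprB.
- move=> /asboolP uv /asboolP vw; apply/asboolP.
  by rewrite -(subrK v u) -addrA; apply: rel_idealD.
Qed.

Definition rel_ideal_eqv := EquivRelPack rel_ideal_equiv.

End TwoSidedIdeal.

(* The sign s is true for x^+ and false for x^-.                              *)
Inductive ygen (N : nat) : Type :=
| XGen of bool & 'Z_N & nat
| HGen of 'Z_N & nat.

Section YGenChoice.
Variable N : nat.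

Definition ygen_code (g : ygen N) : (bool * 'Z_N * nat) + ('Z_N * nat) :=
  match g with XGen s i r => inl (s, i, r) | HGen i r => inr (i, r) end.
Definition ygen_decode (c : (bool * 'Z_N * nat) + ('Z_N * nat)) : ygen N :=
  match c with inl (s, i, r) => XGen s i r | inr (i, r) => HGen i r end.
Lemma ygen_codeK : cancel ygen_code ygen_decode.
Proof. by case. Qed.
HB.instance Definition _ := Choice.copy (ygen N) (can_type ygen_codeK).

End YGenChoice.

(* 'Z_N is Z/NZ only for N >= 2, and the entries below are those of affine    *)
(* type A_{N-1} only for N >= 3.                                              *)
Definition cartan (N : nat) (i j : 'Z_N) : int :=
  if i == j then 2
  else if (i == j + 1) || (i == j - 1) then -1
  else 0.

Definition mcoef (N : nat) (i j : 'Z_N) : int :=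
  if j == i - 1 then 1
  else if j == i + 1 then -1
  else 0.

Definition pm (s : bool) : int := if s then 1 else -1.

Section YangianRelations.
Variables (K : fieldType) (N : nat) (e1 e2 : K) (A : lalgType K).
Variables (x : bool -> 'Z_N -> nat -> A) (h : 'Z_N -> nat -> A).

Definition serre_sum (s : bool) (i j : 'Z_N)
    (r : 'I_`|1 - cartan i j|%N -> nat) (t : nat) : A :=
  \sum_(w : 'S_`|1 - cartan i j|%N)
    foldr (fun k y => bracket (x s i (r (w k))) y) (x s j t)
          (enum 'I_`|1 - cartan i j|%N).

Inductive yangian_rel : A -> A -> Prop :=
| rel_hh i j r t : yangian_rel (bracket (h i r) (h j t)) 0
| rel_xx i j r t :
    yangian_rel (bracket (x true i r) (x false j t)) (if i == j then h i (r + t)%N else 0)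
| rel_h0x s i j r :
    yangian_rel (bracket (h i 0) (x s j r)) ((pm s * cartan i j)%:~R *: x s j r)
| rel_hx s i j r t :
    yangian_rel
      (bracket (h i r.+1) (x s j t) - bracket (h i r) (x s j t.+1))
      (((pm s * cartan i j)%:~R * ((e1 + e2) / 2)) *: anticomm (h i r) (x s j t)
       - ((mcoef i j)%:~R * ((e1 - e2) / 2)) *: bracket (h i r) (x s j t))
| rel_xxs s i j r t :
    yangian_rel
      (bracket (x s i r.+1) (x s j t) - bracket (x s i r) (x s j t.+1))
      (((pm s * cartan i j)%:~R * ((e1 + e2) / 2)) *: anticomm (x s i r) (x s j t)
       - ((mcoef i j)%:~R * ((e1 - e2) / 2)) *: bracket (x s i r) (x s j t))
| rel_serre s i j r t of i != j : yangian_rel (serre_sum s (i := i) (j := j) r t) 0.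

End YangianRelations.

Lemma rmorph_bracket (A B : pzRingType) (f : {rmorphism A -> B}) u v :
  f (bracket u v) = bracket (f u) (f v).
Proof. by rewrite /bracket rmorphB !rmorphM. Qed.

Lemma yangian_rel_lift (K : fieldType) (N : nat) (e1 e2 : K) (A B : lalgType K)
    (f : {lrmorphism A -> B}) (x : bool -> 'Z_N -> nat -> A) h :
  (forall u v, yangian_rel e1 e2 x h u v -> f u = f v) ->
  forall u v, yangian_rel e1 e2 (fun s i r => f (x s i r)) (fun i r => f (h i r)) u v ->
  u = v.
Proof.
move=> rel_f.
have fac a b : f (anticomm a b) = anticomm (f a) (f b).
  by rewrite /anticomm rmorphD !rmorphM.
have fbr := rmorph_bracket f.
have fB a b : f (a - b) = f a - f b by exact: rmorphB.
have fZ c a : f (c *: a) = c *: f a by exact: linearZ.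
have f0 : f 0 = 0 by exact: rmorph0.
move=> u v; case=> {u v} [i j r t|i j r t|s i j r|s i j r t|s i j r t|s i j r t ij].
- by rewrite -fbr -f0; apply/rel_f/rel_hh.
- by rewrite -fbr -f0 -(fun_if f); apply/rel_f/rel_xx.
- by rewrite -fbr -fZ; apply/rel_f/rel_h0x.
- by rewrite -!fbr -fac -!fZ -!fB; apply/rel_f/rel_hx.
- by rewrite -!fbr -fac -!fZ -!fB; apply/rel_f/rel_xxs.
- transitivity (f (serre_sum x s r t)).
    rewrite /serre_sum linear_sum; apply: eq_bigr => w _.
    by elim: (enum _) => //= k l ->; rewrite -fbr.
  by rewrite -f0; apply/rel_f/rel_serre.
Qed.

(* All relations hold when the generators are sent to 0.                      *)
Lemma rel_ideal_aug (K : fieldType) (N : nat) (e1 e2 : K) (A : lalgType K)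
    (x : bool -> 'Z_N -> nat -> A) (h : 'Z_N -> nat -> A) (aug : A -> K) :
  {morph aug : a b / a - b} -> {morph aug : a b / a * b} ->
  (forall c a, aug (c *: a) = c * aug a) ->
  (forall s i r, aug (x s i r) = 0) -> (forall i r, aug (h i r) = 0) ->
  forall u, rel_ideal (yangian_rel e1 e2 x h) u -> aug u = 0.
Proof.
move=> augB augM augZ augx augh.
have aug0 : aug 0 = 0 by rewrite -[X in aug X](subrr 0) augB subrr.
have augD a b : aug (a + b) = aug a + aug b.
  by rewrite -[X in a + X]opprK augB -sub0r augB aug0 sub0r opprK.
have augg := (augx, augh).
have augbr a b : aug (bracket a b) = 0.
  by rewrite /bracket augB !augM mulrC subrr.
have augac a b : aug a = 0 -> aug (anticomm a b) = 0.
  by rewrite /anticomm augD !augM => ->; rewrite mul0r mulr0 addr0.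
move=> u; elim=> {u} [u v Suv||u v _ Hu _ Hv|w u _ Hu|u w _ Hu].
- rewrite augB; case: Suv => {u v} [i j r t|i j r t|s i j r|s i j r t|s i j r t|s i j r t ij].
  + by rewrite augbr aug0 subrr.
  + by rewrite augbr; case: ifP => _; rewrite ?augg ?aug0 subrr.
  + by rewrite augbr augZ augg mulr0 subrr.
  + by rewrite augB !augbr augB !augZ augbr augac ?augg // !mulr0 !subrr.
  + by rewrite augB !augbr augB !augZ augbr augac ?augg // !mulr0 !subrr.
  + rewrite aug0; suff -> : aug (serre_sum x s r t) = 0 by rewrite subrr.
    rewrite /serre_sum; apply: (big_ind (fun w => aug w = 0)) => //.
      by move=> a b a0 b0; rewrite augD a0 b0 addr0.
    by move=> w _; case: (enum _) => [|k l] /=; rewrite ?augg ?augbr.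
- exact: aug0.
- by rewrite augD Hu Hv addr0.
- by rewrite augM Hu mulr0.
- by rewrite augM Hu mul0r.
Qed.

(* Local nilpotency of ad x_{i,0}, for any algebra satisfying the relations   *)
(* and generated by the x and h.                                              *)
Section LocallyNilpotent.
Variables (K : numFieldType) (N : nat) (e1 e2 : K) (A : algType K).
Variables (x : bool -> 'Z_N -> nat -> A) (h : 'Z_N -> nat -> A).
Hypothesis relA : forall u v, yangian_rel e1 e2 x h u v -> u = v.
Hypothesis genA : forall P : A -> Prop,
  P 0 -> P 1 -> (forall s i r, P (x s i r)) -> (forall i r, P (h i r)) ->
  (forall a b, P a -> P b -> P (a + b)) ->
  (forall a b, P a -> P b -> P (a * b)) ->
  (forall c a, P a -> P (c *: a)) ->
  forall a, P a.
Variables (s : bool) (i : 'Z_N).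

Let D := bracket (x s i 0).
Let L (a : A) : Prop := exists n, iter n D a == 0.

Let L0 : L 0. Proof. by exists 0%N. Qed.
Let LS a : L (D a) -> L a.
Proof. by case=> n n0; exists n.+1; rewrite iterSr. Qed.
Let LD a b : L a -> L b -> L (a + b).
Proof.
case=> p /eqP p0 [q /eqP q0]; exists (p + q)%N.
have := iter_linear (bracket (x s i 0)) (p + q) 1 a b; rewrite !scale1r => ->.
by rewrite (iter_eq0 (leq_addr q p) p0) (iter_eq0 (leq_addl p q) q0) addr0.
Qed.
Let LZ c a : L a -> L (c *: a).
Proof.
case=> p /eqP p0; exists p.
have := iter_linear (bracket (x s i 0)) p c a 0; rewrite !addr0 => ->.
by rewrite -/D p0 scaler0 add0r (iter_eq0 (m := 0)).
Qed.
Let LM a b : L a -> L b -> L (a * b).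
Proof.
case=> p /eqP p0 [q /eqP q0]; exists (p + q)%N; apply/eqP.
exact: (iter_mul_eq0 (bracketM (x s i 0)) p0 q0).
Qed.
Let LN a : L a -> L (- a). Proof. by rewrite -scaleN1r; apply: LZ. Qed.
Let LB a b : L a -> L b -> L (a - b). Proof. by move=> ? /LN; apply: LD. Qed.
Let Lbr a b : L a -> L b -> L (bracket a b).
Proof. by move=> La Lb; apply: LB; apply: LM. Qed.
Let Lac a b : L a -> L b -> L (anticomm a b).
Proof. by move=> La Lb; apply: LD; apply: LM. Qed.
Let Lsym a : L (bracket a (x s i 0)) -> L a.
Proof. by move/LN; rewrite -bracketC; apply: LS. Qed.

Let Lx0 : L (x s i 0).
Proof. by apply: LS; rewrite /D /bracket subrr; apply: L0. Qed.

Let Lx1 : L (x s i 1).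
Proof.
apply: Lsym; have := relA (rel_xxs _ _ x h s i i 0 0).
rewrite (bracketC (x s i 0)) opprK -mulr2n -scaler_nat => E.
rewrite -[X in L X](scale1r) -(mulVf (_ : 2%:R != 0 :> K)) ?pnatr_eq0 //.
by rewrite -scalerA E; apply/LZ/LB; apply: LZ; [apply: Lac | apply: Lbr].
Qed.

Let Lx r : L (x s i r).
Proof.
elim: r => [|r IH]; first exact: Lx0.
apply: Lsym; have /eqP := relA (rel_xxs _ _ x h s i i r 0).
rewrite subr_eq => /eqP ->; apply: LD; last exact: Lbr.
by apply: LB; apply: LZ; [apply: Lac | apply: Lbr].
Qed.

Let Lh j r : L (h j r).
Proof.
elim: r => [|r IH]; apply: Lsym.
  by rewrite (relA (rel_h0x _ _ x h s j i 0)); apply: LZ.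
have /eqP := relA (rel_hx _ _ x h s j i r 0).
rewrite subr_eq => /eqP ->; apply: LD; last exact: Lbr.
by apply: LB; apply: LZ; [apply: Lac | apply: Lbr].
Qed.

Let Lx_opp j r : L (x (~~ s) j r).
Proof.
have Lif (b : bool) a : L a -> L (if b then a else 0) by case: b.
move: (@LS (x (~~ s) j r)) (@Lsym (x (~~ s) j r)).
rewrite /D; case: (s) => /= LS' Lsym'.
  by apply: LS'; rewrite (relA (rel_xx _ _ x h i j 0 r)); apply/Lif/Lh.
by apply: Lsym'; rewrite (relA (rel_xx _ _ x h j i r 0)); apply/Lif/Lh.
Qed.

Let Lx_serre j r : i != j -> L (x s j r).
Proof.
move=> ij; have := relA (rel_serre _ _ x h s (fun=> 0%N) r ij).
rewrite /serre_sum; set n := `|_|%N => E.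
have it : foldr (fun _ : 'I_n => D) (x s j r) (enum 'I_n) = iter n D (x s j r).
  by rewrite -[in RHS](size_enum_ord n); elim: (enum _) => //= _ l ->.
exists n; move/eqP: E; rewrite sumr_const it -scaler_nat scaler_eq0.
by rewrite pnatr_eq0 card_Sn -leqn0 leqNgt fact_gt0.
Qed.

Lemma ad_x0_locally_nilpotent : locally_nilpotent (bracket (x s i 0)).
Proof.
apply: genA; [exact: L0 | | | exact: Lh | exact: LD | exact: LM | exact: LZ].
  by apply: LS; rewrite /D /bracket mulr1 mul1r subrr; apply: L0.
move=> s' j r; have [->|ss'] := eqVneq s' s.
  by have [<-|ij] := eqVneq i j; [apply: Lx | apply: Lx_serre].
have -> : s' = ~~ s by case: s s' ss' => [] [].
exact: Lx_opp.
Qed.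

End LocallyNilpotent.

Section Yangian.
Variables (K : numFieldType) (N : nat) (e1 e2 : K).

Local Notation F := (free_alg K (ygen N)).

Definition free_x (s : bool) (i : 'Z_N) (r : nat) : F := free_gen K (XGen s i r).
Definition free_h (i : 'Z_N) (r : nat) : F := free_gen K (HGen i r).

Local Notation I := (rel_ideal (yangian_rel e1 e2 free_x free_h)).
Local Notation equivI := (rel_ideal_eqv (yangian_rel e1 e2 free_x free_h)).

Definition yangian : Type := {eq_quot equivI}.
HB.instance Definition _ := Choice.copy yangian {eq_quot equivI}.

Definition yangian_pi (u : F) : yangian := \pi_{eq_quot equivI} u.
Definition yangian_repr (a : yangian) : F := repr (a : {eq_quot equivI}).

Lemma yangian_piK a : yangian_pi (yangian_repr a) = a.
Proof. exact: reprK. Qed.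

Lemma yangian_piP u v : yangian_pi u = yangian_pi v <-> I (u - v).
Proof.
split=> [/eqmodP /= /asboolP // | uv].
by apply/eqmodP => /=; apply/asboolP.
Qed.

Lemma yangian_reprP u : I (yangian_repr (yangian_pi u) - u).
Proof. by apply/yangian_piP; rewrite yangian_piK. Qed.

Definition yadd a b := yangian_pi (yangian_repr a + yangian_repr b).
Definition yopp a := yangian_pi (- yangian_repr a).
Definition ymul a b := yangian_pi (yangian_repr a * yangian_repr b).
Definition yscale (c : K) a := yangian_pi (c *: yangian_repr a).

Lemma yaddE u v : yadd (yangian_pi u) (yangian_pi v) = yangian_pi (u + v).
Proof.
by apply/yangian_piP; rewrite opprD addrACA; apply: rel_idealD;
  apply: yangian_reprP.
Qed.

Lemma yoppE u : yopp (yangian_pi u) = yangian_pi (- u).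
Proof.
by apply/yangian_piP; rewrite -opprD; apply/rel_idealN/yangian_reprP.
Qed.

Lemma ymulE u v : ymul (yangian_pi u) (yangian_pi v) = yangian_pi (u * v).
Proof.
apply/yangian_piP; set u' := yangian_repr _; set v' := yangian_repr _.
rewrite (_ : _ - _ = (u' - u) * v' + u * (v' - v)).
  by apply: rel_idealD; [apply: rel_idealMr | apply: rel_idealMl];
    apply: yangian_reprP.
by rewrite mulrBl mulrBr addrA subrK.
Qed.

Lemma yscaleE c u : yscale c (yangian_pi u) = yangian_pi (c *: u).
Proof.
apply/yangian_piP; rewrite -scalerBr -[X in _ *: X]mul1r scalerAl.
exact/rel_idealMl/yangian_reprP.
Qed.

Lemma yangianW (P : yangian -> Prop) : (forall u, P (yangian_pi u)) -> forall a, P a.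
Proof. by move=> Ppi a; rewrite -(yangian_piK a). Qed.

Let yE := (yaddE, yoppE, ymulE, yscaleE).

Fact yaddA : associative yadd.
Proof. by do 3!elim/yangianW=> ?; rewrite !yE addrA. Qed.
Fact yaddC : commutative yadd.
Proof. by do 2!elim/yangianW=> ?; rewrite !yE addrC. Qed.
Fact yadd0 : left_id (yangian_pi 0) yadd.
Proof. by elim/yangianW=> ?; rewrite !yE add0r. Qed.
Fact yaddN : left_inverse (yangian_pi 0) yopp yadd.
Proof. by elim/yangianW=> ?; rewrite !yE addNr. Qed.
HB.instance Definition _ := GRing.isZmodule.Build yangian yaddA yaddC yadd0 yaddN.

Lemma free_rel_ideal_aug u : I u -> free_aug u = 0.
Proof.
apply: rel_ideal_aug => [a b|a b|c a|s i r|i r].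
- exact: (raddfB (mcoeff mone)).
- exact: (rmorphM (@mcoeff {fmonom ygen N} K mone)).
- exact: mcoeffZ.
- exact: free_aug_gen.
- exact: free_aug_gen.
Qed.

Fact ymulA : associative ymul.
Proof. by do 3!elim/yangianW=> ?; rewrite !yE mulrA. Qed.
Fact ymul1 : left_id (yangian_pi 1) ymul.
Proof. by elim/yangianW=> ?; rewrite !yE mul1r. Qed.
Fact ymulr1 : right_id (yangian_pi 1) ymul.
Proof. by elim/yangianW=> ?; rewrite !yE mulr1. Qed.
Fact ymulDl : left_distributive ymul yadd.
Proof. by do 3!elim/yangianW=> ?; rewrite !yE mulrDl. Qed.
Fact ymulDr : right_distributive ymul yadd.
Proof. by do 3!elim/yangianW=> ?; rewrite !yE mulrDr. Qed.
Fact yone_neq0 : yangian_pi 1 != 0.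
Proof.
apply/eqP => /yangian_piP /free_rel_ideal_aug; rewrite subr0 => /eqP.
by rewrite [free_aug _](rmorph1 (@mcoeff {fmonom ygen N} K mone)) oner_eq0.
Qed.
HB.instance Definition _ := GRing.Zmodule_isNzRing.Build yangian
  ymulA ymul1 ymulr1 ymulDl ymulDr yone_neq0.

Fact yscaleA c d a : yscale c (yscale d a) = yscale (c * d) a.
Proof. by elim/yangianW: a => ?; rewrite !yE scalerA. Qed.
Fact yscale1 : left_id 1 yscale.
Proof. by elim/yangianW=> ?; rewrite !yE scale1r. Qed.
Lemma yangian_piD u v : yangian_pi (u + v) = yangian_pi u + yangian_pi v.
Proof. by rewrite -yaddE. Qed.
Lemma yangian_piM u v : yangian_pi (u * v) = yangian_pi u * yangian_pi v.
Proof. by rewrite -ymulE. Qed.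

Fact yscaleDr : right_distributive yscale +%R.
Proof.
move=> c a b; elim/yangianW: a => u; elim/yangianW: b => v.
by rewrite -yangian_piD !yscaleE scalerDr yangian_piD.
Qed.
Fact yscaleDl a : {morph yscale^~ a : c d / c + d}.
Proof.
by elim/yangianW: a => u c d; rewrite !yscaleE scalerDl yangian_piD.
Qed.
HB.instance Definition _ := GRing.Zmodule_isLmodule.Build K yangian
  yscaleA yscale1 yscaleDr yscaleDl.

Lemma yangian_piZ c u : yangian_pi (c *: u) = c *: yangian_pi u.
Proof. by rewrite -yscaleE. Qed.

Fact yscaleAl c (a b : yangian) : c *: (a * b) = (c *: a) * b.
Proof.
elim/yangianW: a => u; elim/yangianW: b => v.
by rewrite -yangian_piM -!yangian_piZ -yangian_piM scalerAl.
Qed.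
HB.instance Definition _ := GRing.Lmodule_isLalgebra.Build K yangian yscaleAl.
Fact yscaleAr c (a b : yangian) : c *: (a * b) = a * (c *: b).
Proof.
elim/yangianW: a => u; elim/yangianW: b => v.
by rewrite -yangian_piM -!yangian_piZ -yangian_piM scalerAr.
Qed.
HB.instance Definition _ := GRing.Lalgebra_isAlgebra.Build K yangian yscaleAr.

Fact yangian_pi_is_linear : linear yangian_pi.
Proof. by move=> c u v; rewrite yangian_piD yangian_piZ. Qed.
HB.instance Definition _ :=
  GRing.isLinear.Build K F yangian *:%R yangian_pi yangian_pi_is_linear.
Fact yangian_pi_is_monoid_morphism : monoid_morphism yangian_pi.
Proof. by split; [reflexivity | exact: yangian_piM]. Qed.
HB.instance Definition _ :=
  GRing.isMonoidMorphism.Build F yangian yangian_pi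
    yangian_pi_is_monoid_morphism.

Definition yx (s : bool) (i : 'Z_N) (r : nat) : yangian := yangian_pi (free_x s i r).
Definition yh (i : 'Z_N) (r : nat) : yangian := yangian_pi (free_h i r).

Lemma yangian_relP u v : yangian_rel e1 e2 yx yh u v -> u = v.
Proof.
apply: yangian_rel_lift => {}u {}v uv.
by apply/yangian_piP/rel_ideal_rel.
Qed.

Lemma yangian_ind (P : yangian -> Prop) :
  P 0 -> P 1 -> (forall s i r, P (yx s i r)) -> (forall i r, P (yh i r)) ->
  (forall a b, P a -> P b -> P (a + b)) ->
  (forall a b, P a -> P b -> P (a * b)) ->
  (forall c a, P a -> P (c *: a)) ->
  forall a, P a.
Proof.
move=> P0 P1 Px Ph PD PM PZ; elim/yangianW; elim/free_alg_ind.
- exact: P0.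
- exact: P1.
- by case=> [s i r|i r]; [apply: Px | apply: Ph].
- by move=> u v Pu Pv; rewrite yangian_piD; apply: PD.
- by move=> u v Pu Pv; rewrite yangian_piM; apply: PM.
- by move=> c u Pu; rewrite yangian_piZ; apply: PZ.
Qed.

Lemma ad_yx_locally_nilpotent s i : locally_nilpotent (bracket (yx s i 0)).
Proof. exact: (ad_x0_locally_nilpotent yangian_relP yangian_ind). Qed.

Definition braidT (i : 'Z_N) : yangian -> yangian :=
  exp_ad (ad_yx_locally_nilpotent true i)
  \o exp_ad (locally_nilpotentN (ad_yx_locally_nilpotent false i))
  \o exp_ad (ad_yx_locally_nilpotent true i).

HB.instance Definition _ (i : 'Z_N) := GRing.LRMorphism.copy (braidT i)
  (exp_ad (ad_yx_locally_nilpotent true i)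
   \o exp_ad (locally_nilpotentN (ad_yx_locally_nilpotent false i))
   \o exp_ad (ad_yx_locally_nilpotent true i)).

Lemma braidT_bij i : bijective (braidT i).
Proof. by apply: bij_comp; [apply: bij_comp|]; apply: exp_ad_bij. Qed.

End Yangian.

Arguments yx {K N} e1 e2 s i r.
Arguments yh {K N} e1 e2 i r.
Arguments braidT {K N} e1 e2 i _.

(* Main.v *)
(** A multiplicative linear map phi with phi x = y intertwines exp (ad x) and
    exp (ad y).  Hence it intertwines T_i and T_j as soon as it sends x_i^+ to
    x_j^+ and x_i^- to x_j^-.  When a_ij = 0 apply this to T_i, which fixes
    x_j^+ and x_j^-; when a_ij = -1 apply it to T_i T_j, for which
    T_j x_i^+ = [x_j^+, x_i^+] and T_i [x_j^+, x_i^+] = x_j^+, and similarly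
    for x^-. *)
From HB Require Import structures.
Require Import Defs.
From mathcomp Require Import all_boot all_order all_algebra.
From mathcomp Require Import perm.
From mathcomp Require Import reals complex.
Import GRing.Theory Num.Theory.
Local Open Scope ring_scope.

Set Implicit Arguments.
Unset Strict Implicit.
Unset Printing Implicit Defensive.

(** * Commutator identities *)

Lemma bracketxx (A : pzRingType) (x : A) : bracket x x = 0.
Proof. exact: subrr. Qed.

(** [bracket x] is a derivation of the product, hence of the commutator. *)
Lemma bracket_jacobi (K : comNzRingType) (A : algType K) (x y z : A) :
  bracket x (bracket y z) = bracket (bracket x y) z + bracket y (bracket x z).
Proof.
rewrite {2}/bracket linearB /= !bracketM.
by rewrite [X in _ - X]addrC opprD addrACA.
Qed.

Lemma rmorph_bracket (A B : pzRingType) (phi : {rmorphism A -> B}) (x y : A) :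
  phi (bracket x y) = bracket (phi x) (phi y).
Proof. by rewrite /bracket rmorphB !rmorphM. Qed.

(** * Short exponential series and transport along morphisms *)

Section ExpAdLemmas.
Variables (K : numFieldType) (A : algType K).
Implicit Types (x y v : A).

Lemma exp_ad_fix x (xN : locally_nilpotent (bracket x)) v :
  bracket x v = 0 -> exp_ad xN v = v.
Proof.
move=> v0; rewrite /exp_ad (exp_lnE (f := bracket x) (n := 1) xN v0).
by rewrite big_ord1 /= invr1 scale1r.
Qed.

Lemma exp_ad_2 x (xN : locally_nilpotent (bracket x)) v :
  bracket x (bracket x v) = 0 -> exp_ad xN v = v + bracket x v.
Proof.
move=> v0; rewrite /exp_ad (exp_lnE (f := bracket x) (n := 2) xN v0).
by rewrite !big_ord_recl big_ord0 /= addr0 invr1 !scale1r.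
Qed.

Lemma exp_ad_3 x (xN : locally_nilpotent (bracket x)) v :
  bracket x (bracket x (bracket x v)) = 0 ->
  exp_ad xN v = v + bracket x v + 2^-1 *: bracket x (bracket x v).
Proof.
move=> v0; rewrite /exp_ad (exp_lnE (f := bracket x) (n := 3) xN v0).
by rewrite !big_ord_recl big_ord0 /= addr0 invr1 !scale1r addrA.
Qed.

Lemma exp_ad_intertwine (B : algType K) (phi : {lrmorphism A -> B}) x (y : B)
    (xN : locally_nilpotent (bracket x)) (yN : locally_nilpotent (bracket y)) v :
  phi x = y -> phi (exp_ad xN v) = exp_ad yN (phi v).
Proof.
move=> xy; have iterE k : phi (iter k (bracket x) v) = iter k (bracket y) (phi v).
  by elim: k => //= k <-; rewrite rmorph_bracket /= xy.
(* A cut-off [n] for [v] under [bracket x] also serves [phi v] under [bracket y], so the two finite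
   sums match term by term. *)
have [n /eqP n0] := xN v.
have n0' : iter n (bracket y) (phi v) = 0 by rewrite -iterE n0 linear0.
rewrite /exp_ad (exp_lnE (f := bracket x) xN n0) (exp_lnE (f := bracket y) yN n0').
by rewrite linear_sum; apply: eq_bigr => k _; rewrite linearZ /= iterE.
Qed.

End ExpAdLemmas.

(** * The Weyl operator of a pair [e], [f] *)

Section SL2.
Variables (K : numFieldType) (A : algType K) (e f : A).
Hypotheses (eN : locally_nilpotent (bracket e)).
Hypotheses (fN : locally_nilpotent (bracket (- f))).

(** For [e] = $x_i^+$ and [f] = $x_i^-$ this is $T_i$, freed from the Yangian. *)
Definition weyl : A -> A := exp_ad eN \o exp_ad fN \o exp_ad eN.

HB.instance Definition _ :=
  GRing.LRMorphism.copy weyl (exp_ad eN \o exp_ad fN \o exp_ad eN).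

Lemma weyl_fix v : bracket e v = 0 -> bracket f v = 0 -> weyl v = v.
Proof.
by move=> ev fv; rewrite /weyl /= !exp_ad_fix ?bracketNl ?fv ?oppr0.
Qed.

Let bracketfe v :
  bracket f (bracket e v) = bracket e (bracket f v) - bracket (bracket e f) v.
Proof. by rewrite [in RHS]bracket_jacobi addrC addKr. Qed.

(** Here [v] and $[e,v]$ span a two-dimensional module with lowest vector [v]: the three
    exponentials give $v \mapsto v+[e,v] \mapsto [e,v] \mapsto [e,v]$. *)
Lemma weyl_lowest v : bracket f v = 0 -> bracket e (bracket e v) = 0 ->
  bracket (bracket e f) v = - v -> weyl v = bracket e v.
Proof.
move=> fv eev hv; have fev : bracket f (bracket e v) = v.
  by rewrite bracketfe fv hv linear0 opprK add0r.
have fT : exp_ad fN (v + bracket e v) = bracket e v.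
  rewrite linearD /= exp_ad_fix ?bracketNl ?fv ?oppr0 //.
  rewrite exp_ad_2 !bracketNl ?linearN /= fev ?fv ?oppr0 //.
  by rewrite addrCA subrr addr0.
by rewrite /weyl /= (exp_ad_2 _ eev) fT exp_ad_fix.
Qed.

(** The same module seen from its highest vector: $v \mapsto v \mapsto v-[f,v] \mapsto -[f,v]$, the
    last step because $[e,[f,v]]=v$. *)
Lemma weyl_highest v : bracket e v = 0 -> bracket f (bracket f v) = 0 ->
  bracket (bracket e f) v = v -> weyl v = - bracket f v.
Proof.
move=> ev ffv hv; have efv : bracket e (bracket f v) = v.
  by rewrite bracket_jacobi hv ev linear0 addr0.
have fT : exp_ad fN v = v - bracket f v.
  by rewrite exp_ad_2 !bracketNl ?linearN /= ?ffv ?oppr0.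
rewrite /weyl /= (exp_ad_fix _ ev) fT linearB /= exp_ad_fix // exp_ad_2 efv //.
by rewrite addrC opprD addrNK.
Qed.

(** * Action on the $\mathfrak{sl}_2$-triple [e], $h=[e,f]$, [f] itself *)

Hypothesis he : bracket (bracket e f) e = 2 *: e.
Hypothesis hf : bracket (bracket e f) f = - (2 *: f).

Let half2 (v : A) : 2^-1 *: (2 *: v) = v.
Proof. by rewrite scalerA mulVf ?scale1r // pnatr_eq0. Qed.

Let eh : bracket e (bracket e f) = - (2 *: e).
Proof. by rewrite bracketC he. Qed.
Let fh : bracket f (bracket e f) = 2 *: f.
Proof. by rewrite bracketC hf opprK. Qed.
Let fe : bracket f e = - bracket e f.
Proof. exact: bracketC. Qed.

Let exp_e_e : exp_ad eN e = e.
Proof. by rewrite exp_ad_fix ?bracketxx. Qed.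
Let exp_e_h : exp_ad eN (bracket e f) = bracket e f - 2 *: e.
Proof. by rewrite exp_ad_2 eh // linearN linearZ /= bracketxx scaler0 oppr0. Qed.
Let exp_e_f : exp_ad eN f = f + bracket e f - e.
Proof.
rewrite exp_ad_3 eh ?scalerN ?half2 //.
by rewrite linearN linearZ /= bracketxx scaler0 oppr0.
Qed.
Let exp_f_f : exp_ad fN f = f.
Proof. by rewrite exp_ad_fix // bracketNl bracketxx oppr0. Qed.
Let exp_f_h : exp_ad fN (bracket e f) = bracket e f - 2 *: f.
Proof.
rewrite exp_ad_2 !bracketNl fh // linearN linearZ /= bracketxx.
by rewrite scaler0 !oppr0.
Qed.
Let exp_f_e : exp_ad fN e = e + bracket e f - f.
Proof.
rewrite exp_ad_3 !bracketNl fe !opprK fh ?scalerN ?half2 //.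
by rewrite linearN linearZ /= bracketxx scaler0 !oppr0.
Qed.

(** The final cancellation in [weyl_e] and [weyl_f], with $(u,v,w)$ equal to $(e,f,h)$ and $(f,e,h)$
    respectively. *)
Let sub_double (u v w : A) : u + (w - 2 *: u) - (v + w - u) = - v.
Proof.
rewrite scaler_nat mulr2n !opprD opprK !addrA (addrC u w) addrK.
by rewrite (addrAC _ _ (- w)) (addrAC _ _ (- w)) subrr sub0r addrAC addNr add0r.
Qed.

Lemma weyl_e : weyl e = - f.
Proof.
rewrite /weyl /= exp_e_e exp_f_e linearB linearD /= exp_e_e exp_e_h exp_e_f.
exact: sub_double.
Qed.

Lemma weyl_f : weyl f = - e.
Proof.
have fT : exp_ad fN (f + bracket e f - e) = - e.
  by rewrite linearB linearD /= exp_f_f exp_f_h exp_f_e sub_double.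
by rewrite /weyl /= exp_e_f fT linearN /= exp_e_e.
Qed.

End SL2.

(** * Morphisms intertwining Weyl operators *)

Section WeylIntertwine.
Variables (K : numFieldType) (A : algType K) (e f e' f' : A).
Variables (eN : locally_nilpotent (bracket e)).
Variables (fN : locally_nilpotent (bracket (- f))).
Variables (eN' : locally_nilpotent (bracket e')).
Variables (fN' : locally_nilpotent (bracket (- f'))).

Lemma weyl_intertwine (phi : {lrmorphism A -> A}) v :
  phi e = e' -> phi f = f' -> phi (weyl eN fN v) = weyl eN' fN' (phi v).
Proof.
move=> phie phif; rewrite /weyl /=.
rewrite (exp_ad_intertwine _ eN') // (exp_ad_intertwine _ fN').
  by rewrite (exp_ad_intertwine _ eN').
by rewrite linearN /= phif.
Qed.

Lemma weyl_intertwine_comp (phi psi : {lrmorphism A -> A}) v :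
  phi (psi e) = e' -> phi (psi f) = f' ->
  phi (psi (weyl eN fN v)) = weyl eN' fN' (phi (psi v)).
Proof. exact: (weyl_intertwine (phi := phi \o psi)). Qed.

End WeylIntertwine.

(** Exchanging [i] and [j] swaps the conditions $i=j+1$ and $i=j-1$. *)
Lemma cartan_sym (N : nat) (i j : 'Z_N) : cartan i j = cartan j i.
Proof.
by rewrite /cartan eq_sym -subr_eq -(subr_eq j) orbC (eq_sym (i - 1)) (eq_sym (j - 1)).
Qed.

(** * Action on the generators $x_j^\pm$ and the braid relations *)

Section YangianBraid.
Variables (K : numFieldType) (N : nat) (e1 e2 : K) (A : algType K).
Variables (x : bool -> 'Z_N -> nat -> A) (h : 'Z_N -> nat -> A).
Hypothesis relA : forall u v, yangian_rel e1 e2 x h u v -> u = v.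
Hypothesis eN : forall i, locally_nilpotent (bracket (x true i 0)).
Hypothesis fN : forall i, locally_nilpotent (bracket (- x false i 0)).
Implicit Types i j : 'Z_N.

Local Notation T i := (weyl (eN i) (fN i)).

Lemma bracket_x_opp i j :
  bracket (x true i 0) (x false j 0) = if i == j then h i 0 else 0.
Proof. exact: relA (rel_xx e1 e2 x h i j 0 0). Qed.

Lemma bracket_x_opp0 s i j : i != j -> bracket (x s i 0) (x (~~ s) j 0) = 0.
Proof.
move=> ij; case: s => /=; first by rewrite bracket_x_opp (negPf ij).
by rewrite bracketC bracket_x_opp eq_sym (negPf ij) oppr0.
Qed.

Lemma bracket_h_x s i j :
  bracket (h i 0) (x s j 0) = (pm s * cartan i j)%:~R *: x s j 0.
Proof. exact: relA (rel_h0x e1 e2 x h s i j 0). Qed.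

(** When all indices [r] are zero, every permutation contributes the same nested commutator; the
    Serre sum is $n!$ times it, and $n!$ is invertible in characteristic 0. *)
Lemma serre_iter s i j : i != j ->
  iter `|1 - cartan i j|%N (bracket (x s i 0)) (x s j 0) = 0.
Proof.
move=> ij; have := relA (rel_serre e1 e2 x h s (fun=> 0%N) 0 ij).
rewrite /serre_sum; set n := `|_|%N => /eqP E.
have foldE : foldr (fun _ : 'I_n => bracket (x s i 0)) (x s j 0) (enum 'I_n)
    = iter n (bracket (x s i 0)) (x s j 0).
  by rewrite -[in RHS](size_enum_ord n); elim: (enum _) => //= _ l ->.
move: E; rewrite sumr_const foldE -scaler_nat scaler_eq0 pnatr_eq0 card_Sn.
by rewrite -leqn0 leqNgt fact_gt0 => /eqP.
Qed.

(** Both $x_i^\pm$ commute with $x_j^s$: for equal signs the Serre relation has length one, for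
    opposite signs $i \ne j$ suffices. *)
Lemma weyl_x_fix s i j : cartan i j = 0 -> T i (x s j 0) = x s j 0.
Proof.
move=> a0; have ij : i != j by apply/eqP => eij; move: a0; rewrite /cartan eij eqxx.
have br s' : bracket (x s' i 0) (x s j 0) = 0.
  have [->|] := eqVneq s' s; first by have := serre_iter s ij; rewrite a0.
  move=> ss'; have -> : s = ~~ s' by case: s s' ss' => [] [].
  exact: bracket_x_opp0.
exact: weyl_fix.
Qed.

(** For the triple of [i], $x_j^+$ is a lowest vector of weight $-1$ and $x_j^-$ a highest vector of
    weight $1$; [pm s] records the sign in [weyl_highest]. *)
Lemma weyl_x_adj s i j : cartan i j = -1 ->
  T i (x s j 0) = bracket (x s i 0) (x s j 0) *~ pm s.
Proof.
move=> a1; have ij : i != j by apply/eqP => eij; move: a1; rewrite /cartan eij eqxx.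
have srr s' : bracket (x s' i 0) (bracket (x s' i 0) (x s' j 0)) = 0.
  by have := serre_iter s' ij; rewrite a1.
have opp0 s' := bracket_x_opp0 s' ij.
case: s => /=.
  rewrite mulr1z; apply: weyl_lowest; [exact: (opp0 false) | exact: srr |].
  by rewrite bracket_x_opp eqxx bracket_h_x a1 /= mul1r scaleN1r.
rewrite mulrN1z; apply: weyl_highest; [exact: (opp0 true) | exact: srr |].
by rewrite bracket_x_opp eqxx bracket_h_x a1 /= mulrNN mul1r scale1r.
Qed.

Lemma weyl_x_self s i : T i (x s i 0) = - x (~~ s) i 0.
Proof.
have a2 : cartan i i = 2 by rewrite /cartan eqxx.
have hx s' : bracket (bracket (x true i 0) (x false i 0)) (x s' i 0)
    = (pm s' * 2)%:~R *: x s' i 0.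
  by rewrite bracket_x_opp eqxx bracket_h_x a2.
have he : bracket (bracket (x true i 0) (x false i 0)) (x true i 0)
    = 2 *: x true i 0 by rewrite hx mul1r.
have hf : bracket (bracket (x true i 0) (x false i 0)) (x false i 0)
    = - (2 *: x false i 0) by rewrite hx mulN1r mulrNz scaleNr.
by case: s; [apply: weyl_e | apply: weyl_f].
Qed.

Lemma weyl2_x s i j : cartan i j = -1 -> T i (T j (x s i 0)) = x s j 0.
Proof.
move=> a1; have ij : i != j by apply/eqP => eij; move: a1; rewrite /cartan eij eqxx.
have aji : cartan j i = -1 by rewrite cartan_sym.
rewrite weyl_x_adj // rmorphMz rmorph_bracket.
rewrite [X in bracket X _](weyl_x_adj _ a1) [X in bracket _ X]weyl_x_self.
have opp0 : bracket (x (~~ s) i 0) (x s j 0) = 0.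
  by have := bracket_x_opp0 (~~ s) ij; rewrite negbK.
(* $[x_i^{-s},x_i^s]$ is $-s\,h_i$ and $h_i$ acts on $x_j^s$ by $-s$, so the scalar is 1 for both
   signs. *)
have hx : bracket (bracket (x (~~ s) i 0) (x s i 0)) (x s j 0) = x s j 0.
  case: (s) => /=; last first.
    by rewrite bracket_x_opp eqxx bracket_h_x a1 /= mulrNN mul1r scale1r.
  rewrite [X in bracket X _]bracketC bracketNl bracket_x_opp eqxx.
  by rewrite bracket_h_x a1 /= mul1r scaleN1r opprK.
(* The minus sign of [weyl_x_self] is absorbed by flipping the commutator, and the two factors
   [pm s] multiply to 1. *)
rewrite bracketC bracketNl opprK raddfMz /= bracket_jacobi opp0 linear0 addr0.
by rewrite hx -mulrzA; case: (s).
Qed.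

Lemma weyl_braid i j :
  (cartan i j = 0 -> T i \o T j =1 T j \o T i) /\
  (cartan i j = -1 -> T i \o T j \o T i =1 T j \o T i \o T j).
Proof.
split=> aij v; rewrite ![(_ \o _) _]/=.
  by apply: weyl_intertwine; apply: weyl_x_fix.
(* Read as $(T_iT_j)T_i = T_j(T_iT_j)$. *)
by apply: weyl_intertwine_comp; apply: weyl2_x.
Qed.

End YangianBraid.

Theorem proposition3p1 (R : realType) (N : nat) (hN : (3 <= N)%N)
    (e1 e2 : R[i]) (i j : 'Z_N) :
  (cartan i j = 0 ->
     braidT e1 e2 i \o braidT e1 e2 j =1 braidT e1 e2 j \o braidT e1 e2 i) /\
  (cartan i j = -1 ->
     braidT e1 e2 i \o braidT e1 e2 j \o braidT e1 e2 i
     =1 braidT e1 e2 j \o braidT e1 e2 i \o braidT e1 e2 j).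
Proof.
(* [braidT] is convertible to [weyl] taken with these same nilpotency proofs. *)
exact: (weyl_braid (@yangian_relP _ _ e1 e2)
  (@ad_yx_locally_nilpotent _ _ e1 e2 true)
  (fun k => locally_nilpotentN (@ad_yx_locally_nilpotent _ _ e1 e2 false k)) i j).
Qed.
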